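(* In the setting described in the context, let $0\le p\le n$, $\eta'\in\mathcal P(E_p)$ and $f\in\mathrm{Osc}_1(E_n)$. There exists a function $\mathcal D_{p,n,\eta'}(f)\in\mathrm{Osc}_1(E_p)$, depending only on $(p,n,\eta')$ and $f$, such that for every $\eta\in\mathcal P(E_p)$ and every $m\in I_p$, $$\left|\left[\Gamma^2_{p,n}(m,\eta)-\Gamma^2_{p,n}(m,\eta')\right](f)\right|\le 2\,\alpha^\star_{p,n}\,q_{p,n}\Big[q_{p,n}\,\beta(P_{p,n})\,\big|(\eta-\eta')\mathcal D_{p,n,\eta'}(f)\big|+\beta_{p,n}\,\big|(\eta-\eta')h_{p,n,\eta'}\big|\Big],$$ where $h_{p,n,\eta'}=\frac1{2q_{p,n}}\frac{Q_{p,n}(1)}{\eta'Q_{p,n}(1)}\in\mathrm{Osc}_1(E_p)$ and $$\alpha^\star_{p,n}:=1\wedge\left[m_+(p)\left\|\frac{Q_{p,n}(1)}{\sum_{p<q\le n}c_{q,n}}\right\|\right],\qquad \beta_{p,n}:=\sum_{p<q\le n}\frac{c_{q,n}}{\sum_{p<r\le n}c_{r,n}}\,\beta(P_{q,n}),\qquad c_{q,n}:=\mu_qQ_{q,n}(1).$$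
   Context: $(E_n)_{n\ge0}$ are measurable spaces; $G_n:E_n\to\mathbb R$ measurable with $0<g_{n,-}\le G_n\le g_{n,+}<\infty$; $M_{n+1}$ is a Markov kernel from $E_n$ to $E_{n+1}$; $\mu_n$ is a finite positive measure on $E_n$, with $\mu_0(1)>0$. $Q_{n+1}(x,dy)=G_n(x)M_{n+1}(x,dy)$, $Q_{p,n}=Q_{p+1}\cdots Q_n$, $Q_{n,n}=Id$. $\mathcal P(E)$ is the set of probability measures on $E$; $\mathrm{Osc}_1(E)$ the set of measurable $f$ on $E$ with $\mathrm{osc}(f)=\sup_{x,y}|f(x)-f(y)|\le1$; $\|\cdot\|$ is the uniform norm. For $m>0$ and $\eta\in\mathcal P(E_n)$, $\Gamma_{n+1}(m,\eta)=(\Gamma^1_{n+1}(m,\eta),\Gamma^2_{n+1}(m,\eta))\in(0,\infty)\times\mathcal P(E_{n+1})$ with $$\Gamma^1_{n+1}(m,\eta)=m\,\eta(G_n)+\mu_{n+1}(1),\qquad \Gamma^2_{n+1}(m,\eta)(f)=\frac{m\,\eta(Q_{n+1}(f))+\mu_{n+1}(f)}{m\,\eta(G_n)+\mu_{n+1}(1)}.$$ $\Gamma_{p,n}=\Gamma_n\circ\Gamma_{n-1}\circ\cdots\circ\Gamma_{p+1}$, $\Gamma_{n,n}=Id$, and $\Gamma^2_{p,n}$ is its second component. $P_{p,n}(f)=Q_{p,n}(f)/Q_{p,n}(1)$; $q_{p,n}=\sup_{x,y\in E_p}Q_{p,n}(1)(x)/Q_{p,n}(1)(y)$; $\beta(P_{p,n})=\sup_{x,y\in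 E_p}\sup_{f\in\mathrm{Osc}_1(E_n)}|P_{p,n}(f)(x)-P_{p,n}(f)(y)|$. $I_p=[m_-(p),m_+(p)]$ with $m_\pm(p)=\sum_{q=0}^p\mu_q(1)g_\pm(p)^{p-q}$, $g_-(p)=\inf_{0\le q<p}\inf_{E_q}G_q$, $g_+(p)=\sup_{0\le q<p}\sup_{E_q}G_q$ (for $p=0$, $m_\pm(0)=\mu_0(1)$). Convention: when $\sum_{p<q\le n}c_{q,n}=0$ (in particular $p=n$), $\alpha^\star_{p,n}:=1$ and $\beta_{p,n}:=0$. *)

(* Defs.v *)
From HB Require Import structures.
From mathcomp Require Import all_boot all_order all_algebra.
From mathcomp Require Import all_classical all_reals all_analysis.
From mathcomp Require Import measurable_realfun.

Set Implicit Arguments.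
Unset Strict Implicit.
Unset Printing Implicit Defensive.

Import Order.TTheory GRing.Theory Num.Theory.
Import numFieldNormedType.Exports.

Local Open Scope classical_set_scope.
Local Open Scope ring_scope.

(* Index shift: [M X n] is the Markov kernel M_{n+1} from E_n to E_{n+1};
   likewise [Qker] and [Qop] at [n] are Q_{n+1}, and [Gamma_step] at [n] is
   Gamma_{n+1}. *)
Record model (R : realType) := Model {
  disp : nat -> measure_display;
  E : forall n, measurableType (disp n);
  G : forall n, E n -> R;
  g_lo : nat -> R;
  g_hi : nat -> R;
  measurable_G : forall n, measurable_fun setT (@G n);
  g_lo_gt0 : forall n, 0 < g_lo n;
  G_bounds : forall n (x : E n), g_lo n <= @G n x <= g_hi n;
  M : forall n, R.-pker E n ~> E n.+1;
  mu : forall n, {finite_measure set (E n) -> \bar R};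
  mu0_gt0 : (0 < mu 0 setT)%E }.

Arguments E {R} _ _.
Arguments G {R} _ _ _.
Arguments g_lo {R} _ _.
Arguments g_hi {R} _ _.
Arguments M {R} _ _.
Arguments mu {R} _ _.

Section oscillation.
Context d (T : measurableType d) (R : realType).

Definition osc (f : T -> R) : \bar R :=
  ereal_sup [set (`|f z.1 - f z.2|)%:E | z in [set: T * T]].

Definition Osc1 (f : T -> R) : Prop := measurable_fun setT f /\ (osc f <= 1)%E.

Definition unif_norm (f : T -> R) : R := sup [set `|f x| | x in [set: T]].

End oscillation.

Section semigroup.
Context (R : realType) (X : model R).

Lemma G_gt0 n (x : E X n) : 0 < G X n x.
Proof. by have /andP[+ _] := G_bounds x; apply: lt_le_trans (g_lo_gt0 _ _). Qed.

Definition Qker n (x : E X n) : {measure set (E X n.+1) -> \bar R} :=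
  mscale (NngNum (ltW (G_gt0 x))) (M X n x).

Definition Qop n (f : E X n.+1 -> R) : E X n -> R :=
  fun x => \int[Qker x]_y f y.

(* Q_{p+1} ... Q_{p+k}. *)
Fixpoint Qiter p k : (E X (k + p) -> R) -> E X p -> R :=
  match k with
  | 0 => id
  | k'.+1 => fun f => Qiter (Qop f)
  end.

(* The transport along (n - p) + p = n only identifies types. *)
Definition Q p n (pn : (p <= n)%N) : (E X n -> R) -> E X p -> R :=
  ecast i ((E X i -> R) -> E X p -> R) (subnK pn) (@Qiter p (n - p)).

Lemma Q_cast p k n (e : (k + p)%N = n) (pn : (p <= n)%N) :
  @Q p n pn = ecast i ((E X i -> R) -> E X p -> R) e (@Qiter p k).
Proof.
have ek : k = (n - p)%N by rewrite -e addnK.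
by subst k; rewrite /Q (eq_irrelevance e (subnK pn)).
Qed.

Lemma Q_nn n (f : E X n -> R) : Q (leqnn n) f = f.
Proof. by rewrite (@Q_cast n 0 n erefl). Qed.

Lemma Q_S p n (pn : (p <= n)%N) (pn1 : (p <= n.+1)%N) (f : E X n.+1 -> R) :
  Q pn1 f = Q pn (Qop f).
Proof.
have e := subnK pn; move: (n - p)%N e pn pn1 f => k e; subst n => pn pn1 f.
by rewrite (@Q_cast p k _ erefl) (@Q_cast p k.+1 _ erefl).
Qed.

Definition Q1 p n (pn : (p <= n)%N) : E X p -> R := Q pn (cst 1).

Definition P p n (pn : (p <= n)%N) (f : E X n -> R) : E X p -> R :=
  fun x => Q pn f x / Q1 pn x.

(* The real-valued suprema and infima below ([unif_norm] included) are never
   the default value of [sup] and [inf]: all E_n are nonempty because of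
   [mu0_gt0] and the Markov kernels, and the sets are bounded because of
   [G_bounds]. The only exception is the infimum and supremum over i < p for
   p = 0, which only enter through their 0-th power. *)
Definition q p n (pn : (p <= n)%N) : R :=
  sup [set Q1 pn z.1 / Q1 pn z.2 | z in [set: E X p * E X p]].

Definition betaP p n (pn : (p <= n)%N) : R :=
  sup [set `|P pn fz.1 fz.2.1 - P pn fz.1 fz.2.2| |
       fz in [set f : E X n -> R | Osc1 f] `*` [set: E X p * E X p]].

Definition g_minus p : R :=
  inf [set inf [set G X i x | x in [set: E X i]] | i in [set i | (i < p)%N]].

Definition g_plus p : R :=
  sup [set sup [set G X i x | x in [set: E X i]] | i in [set i | (i < p)%N]].

Definition mass n : R := fine (mu X n setT).

Definition m_minus p : R := \sum_(i < p.+1) mass i * g_minus p ^+ (p - i).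

Definition m_plus p : R := \sum_(i < p.+1) mass i * g_plus p ^+ (p - i).

Definition c p n (pn : (p <= n)%N) : R := \int[mu X p]_x Q1 pn x.

(* [leq_ord i : i <= n] for [i : 'I_n.+1]. *)
Definition csum p n : R := \sum_(i < n.+1 | (p < i)%N) c (leq_ord i).

Definition alphaStar p n (pn : (p <= n)%N) : R :=
  if csum p n == 0 then 1
  else Num.min 1 (m_plus p * unif_norm (fun x => Q1 pn x / csum p n)).

Definition beta p n : R :=
  if csum p n == 0 then 0
  else \sum_(i < n.+1 | (p < i)%N) c (leq_ord i) / csum p n * betaP (leq_ord i).

Definition h p n (pn : (p <= n)%N) (eta' : probability (E X p) R) : E X p -> R :=
  fun x => (2 * q pn)^-1 * (Q1 pn x / \int[eta']_y Q1 pn y).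

End semigroup.

Section Gamma.
Context (R : realType) (X : model R).

Lemma mass_ge0 n : 0 <= mass X n.
Proof. exact: fine_ge0. Qed.

Lemma integrable_G n (eta : probability (E X n) R) :
  eta.-integrable setT (EFin \o @G _ X n).
Proof.
apply: measurable_bounded_integrable => //.
- exact: (eq_ind_r (fun z => z < +oo)%E (ltry 1) (probability_setT eta)).
- exact: measurable_G.
- exists (g_hi X n); split; first exact: num_real.
  move=> r hr x _ /=; rewrite gtr0_norm ?G_gt0//.
  by have /andP[_ /le_trans] := G_bounds x; apply; exact: ltW.
Qed.

Lemma eta_G_gt0 n (eta : probability (E X n) R) : 0 < \int[eta]_x G X n x.
Proof.
apply: (lt_le_trans (g_lo_gt0 X n)).
have -> : g_lo X n = \int[eta]_x (cst (g_lo X n) x).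
  rewrite Rintegral_cst// [X in fine X](_ : _ = 1%E) ?mulr1//.
  exact: probability_setT.
apply: le_Rintegral => //.
- exact: finite_measure_integrable_cst.
- exact: integrable_G.
- by move=> x _; have /andP[] := G_bounds x.
Qed.

Section step.
Context (n : nat) (m : {posnum R}) (eta : probability (E X n) R).

Definition Gamma1_val : R := m%:num * \int[eta]_x G X n x + mass X n.+1.

Lemma Gamma1_gt0 : 0 < Gamma1_val.
Proof. by rewrite ltr_pwDl ?mass_ge0// mulr_gt0// eta_G_gt0. Qed.

Definition Gamma1 : {posnum R} := PosNum Gamma1_gt0.

(* The defining formula of Gamma^2_{n+1}(m, eta) at the indicator of A. *)
Definition Gamma2_val (A : set (E X n.+1)) : \bar R :=
  ((Gamma1_val^-1)%:E *
   (m%:num%:E * \int[eta]_x Qker x A + mu X n.+1 A))%E.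

Lemma measurable_Qker A : measurable A ->
  measurable_fun [set: E X n] ((@Qker _ X n) ^~ A).
Proof.
move=> mA; apply: emeasurable_funM; last exact: measurable_kernel.
exact/measurable_EFinP/measurable_G.
Qed.

Let Gamma20 : Gamma2_val set0 = 0%E.
Proof.
by rewrite /Gamma2_val measure0 adde0 integral0_eq ?mule0.
Qed.

Let Gamma2_ge0 A : (0 <= Gamma2_val A)%E.
Proof.
rewrite mule_ge0 ?lee_fin ?invr_ge0 ?(ltW Gamma1_gt0)// adde_ge0//.
by rewrite mule_ge0// integral_ge0.
Qed.

Let Gamma2_sigma : semi_sigma_additive Gamma2_val.
Proof.
move=> F mF tF mUF.
rewrite [X in X @ _ --> _](_ : _ = (fun k => ((Gamma1_val^-1)%:E *
   (m%:num%:E * \sum_(0 <= i < k) (\int[eta]_x Qker x (F i)) +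
    \sum_(0 <= i < k) mu X n.+1 (F i)))%E)); last first.
  apply/funext => k; rewrite /Gamma2_val -ge0_sume_distrr; last first.
    by move=> i _; rewrite adde_ge0// mule_ge0// integral_ge0.
  rewrite big_split/= ge0_sume_distrr// => i _; exact: integral_ge0.
apply: cvgeZl => //.
have iQ : (\int[eta]_x Qker x (\bigcup_k F k) =
          \sum_(0 <= i <oo) \int[eta]_x Qker x (F i))%E.
  rewrite -integral_nneseries//; last by move=> i; exact: measurable_Qker.
  by apply: eq_integral => x _; exact: measure_semi_bigcup.
apply: cvgeD.
- by rewrite ge0_adde_def// inE ?mule_ge0 ?integral_ge0.
- apply: cvgeZl => //; rewrite iQ.
  by apply: is_cvg_nneseries => i _ _; exact: integral_ge0.
- exact: measure_semi_sigma_additive.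
Qed.

HB.instance Definition _ := isMeasure.Build _ _ _ Gamma2_val
  Gamma20 Gamma2_ge0 Gamma2_sigma.

Let Gamma2_setT : Gamma2_val setT = 1%E.
Proof.
have QT : (\int[eta]_x Qker x setT)%E = (\int[eta]_x G X n x)%:E.
  rewrite /Rintegral fineK; last exact: integrable_fin_num (integrable_G eta).
  by apply: eq_integral => x _; rewrite /Qker/= /mscale/= prob_kernel mule1.
rewrite /Gamma2_val QT -[mu X n.+1 setT]fineK ?fin_num_measure//.
by rewrite -[RHS](congr1 EFin (mulVf (lt0r_neq0 Gamma1_gt0))).
Qed.

HB.instance Definition _ := Measure_isProbability.Build _ _ _ Gamma2_val
  Gamma2_setT.

Definition Gamma2 : probability (E X n.+1) R := Gamma2_val.

End step.

Definition state n : Type := {posnum R} * probability (E X n) R.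

Definition Gamma_step n (s : state n) : state n.+1 :=
  (Gamma1 s.1 s.2, Gamma2 s.1 s.2).

Fixpoint Gamma_iter p k : state p -> state (k + p) :=
  match k with
  | 0 => id
  | k'.+1 => fun s => Gamma_step (Gamma_iter k' s)
  end.

Definition Gamma p n (pn : (p <= n)%N) : state p -> state n :=
  ecast i (state p -> state i) (subnK pn) (@Gamma_iter p (n - p)).

Lemma Gamma_cast p k n (e : (k + p)%N = n) (pn : (p <= n)%N) :
  @Gamma p n pn = ecast i (state p -> state i) e (@Gamma_iter p k).
Proof.
have ek : k = (n - p)%N by rewrite -e addnK.
by subst k; rewrite /Gamma (eq_irrelevance e (subnK pn)).
Qed.

Lemma Gamma_nn n (s : state n) : Gamma (leqnn n) s = s.
Proof. by rewrite (@Gamma_cast n 0 n erefl). Qed.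

Lemma Gamma_S p n (pn : (p <= n)%N) (pn1 : (p <= n.+1)%N) (s : state p) :
  Gamma pn1 s = Gamma_step (Gamma pn s).
Proof.
have e := subnK pn; move: (n - p)%N e pn pn1 => k e; subst n => pn pn1.
by rewrite (@Gamma_cast p k _ erefl) (@Gamma_cast p k.+1 _ erefl).
Qed.

End Gamma.

(* Main.v *)
(** With [a = eta Q_{p,n}(1)], [C = \sum_{p<q<=n} c_{q,n}] and
    [S = \sum_{p<q<=n} mu_q Q_{q,n}(f)], induction on [n] gives
    [Gamma^2_{p,n}(m, eta)(f) = (m eta Q_{p,n}(f) + S) / (m a + C)]; write [a']
    and [u = eta' Q_{p,n}(f) / a'] for the quantities at [eta'].  Then
    [(Gamma^2(m, eta) - Gamma^2(m, eta'))(f)] equals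
    [m (eta Q_{p,n}(f) - a u) / (m a + C)
     - (S - C u) m (a - a') / ((m a + C) (m a' + C))].
    The weights [m a / (m a + C)] and [m a' / (m a' + C)] are at most
    [alphaStar].  The first numerator is [m eta (Q_{p,n}(f) - u Q_{p,n}(1))],
    whose integrand has zero mean under [eta'] and is, up to the factor
    [q_{p,n} a' beta(P_{p,n})], a function [D] of oscillation at most 1.  In the
    second term [a - a'] is [2 q_{p,n} a' (eta - eta') h], and
    [|S - C u| <= C beta_{p,n}] because [u] is, for each [q], an average of the
    values of [P_{q,n}(f)]. *)
From HB Require Import structures.
Require Import Defs.
From mathcomp Require Import all_boot all_order all_algebra.
From mathcomp Require Import all_classical all_reals all_analysis.
From mathcomp Require Import measurable_realfun ring lra.

Set Implicit Arguments.
Unset Strict Implicit.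
Unset Printing Implicit Defensive.

Import Order.TTheory GRing.Theory Num.Theory.

Local Open Scope classical_set_scope.
Local Open Scope ring_scope.

(** * Bounded measurable functions and oscillation *)

Section bounded_measurable.
Context d (T : measurableType d) (R : realType).
Implicit Types (f g : T -> R) (k K : R) (mu : {measure set T -> \bar R}).

(** The working class of integrands: it contains [Osc1], is stable under [Qop], and is integrable
    against every finite measure, so that real-valued integrals are linear and monotone on it. *)
Definition bmeas f := measurable_fun setT f /\ exists K, forall x, `|f x| <= K.

Lemma bmeas_cst k : bmeas (fun=> k).
Proof. by split; [exact: measurable_cst | exists `|k|]. Qed.

Lemma bmeasD f g : bmeas f -> bmeas g -> bmeas (fun x => f x + g x).
Proof.
move=> [mf [K fK]] [mg [L gL]]; split; first exact: measurable_funD.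
by exists (K + L) => x; rewrite (le_trans (ler_normD _ _))// lerD.
Qed.

Lemma bmeasM f g : bmeas f -> bmeas g -> bmeas (fun x => f x * g x).
Proof.
move=> [mf [K fK]] [mg [L gL]]; split; first exact: measurable_funM.
by exists (K * L) => x; rewrite normrM ler_pM.
Qed.

Lemma bmeasZ k f : bmeas f -> bmeas (fun x => k * f x).
Proof. by move=> bf; apply: bmeasM => //; exact: bmeas_cst. Qed.

Lemma bmeasB f g : bmeas f -> bmeas g -> bmeas (fun x => f x - g x).
Proof.
move=> bf bg.
rewrite (_ : (fun x => _) = (fun x => f x + -1 * g x)).
  by apply: bmeasD => //; exact: bmeasZ.
by apply/funext => x; rewrite mulN1r.
Qed.

Lemma bmeas_integrable mu f : (mu setT < +oo)%E -> bmeas f ->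
  mu.-integrable setT (EFin \o f).
Proof.
move=> muT [mf [K fK]]; apply: measurable_bounded_integrable => //.
exists K; split; first exact: num_real.
by move=> r Kr x _ /=; rewrite (le_trans (fK x))// ltW.
Qed.

Lemma Osc1_dist f : Osc1 f -> forall x y, `|f x - f y| <= 1.
Proof.
move=> [_ fosc] x y; rewrite -lee_fin; apply: le_trans fosc.
by apply: ereal_sup_ubound; exists (x, y).
Qed.

(** The one-sided bound suffices because [x] and [y] may be exchanged. *)
Lemma dist_Osc1 f : measurable_fun setT f -> (forall x y, f x - f y <= 1) ->
  Osc1 f.
Proof.
move=> mf fd; split=> //; apply: ge_ereal_sup => _ [[x y] _ <-] /=.
by rewrite lee_fin ler_norml fd andbT lerNl opprB fd.
Qed.

Lemma Osc1_bmeas f : Osc1 f -> bmeas f.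
Proof.
move=> of1; split; first by case: of1.
exists (`|f point| + 1) => x; rewrite -(subrK (f point) (f x)) addrC.
by rewrite (le_trans (ler_normD _ _))// lerD2l Osc1_dist.
Qed.

End bounded_measurable.

(** * The one-step operators on bounded measurable functions *)

Section semigroup.
Context (R : realType) (X : model R).

Lemma QkerT n (x : E X n) : (Qker x setT = (G X n x)%:E)%E.
Proof. by rewrite /Qker/= /mscale/= prob_kernel mule1. Qed.

Lemma QkerT_lty n (x : E X n) : (Qker x setT < +oo)%E.
Proof. by rewrite QkerT ltry. Qed.

Lemma Qop_cst n k : Qop (fun=> k) = (fun x : E X n => k * G X n x).
Proof. by apply/funext => x; rewrite /Qop Rintegral_cst// QkerT. Qed.

Lemma Qop_le n (f g : E X n.+1 -> R) : bmeas f -> bmeas g ->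
  (forall x, f x <= g x) -> forall x, Qop f x <= Qop g x.
Proof.
move=> bf bg fg x.
by apply: le_Rintegral => //; apply: bmeas_integrable => //; exact: QkerT_lty.
Qed.

Lemma QopD n (f g : E X n.+1 -> R) : bmeas f -> bmeas g ->
  Qop (fun x => f x + g x) = (fun x => Qop f x + Qop g x).
Proof.
move=> bf bg; apply/funext => x; rewrite /Qop RintegralD//;
  by apply: bmeas_integrable => //; exact: QkerT_lty.
Qed.

Lemma QopZ n k (f : E X n.+1 -> R) : bmeas f ->
  Qop (fun x => k * f x) = (fun x => k * Qop f x).
Proof.
move=> bf; apply/funext => x; rewrite /Qop RintegralZl//.
by apply: bmeas_integrable => //; exact: QkerT_lty.
Qed.

Lemma Qop_norm n (f : E X n.+1 -> R) K : bmeas f ->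
  (forall x, `|f x| <= K) -> forall x, `|Qop f x| <= K * g_hi X n.
Proof.
move=> bf fK x; have K0 : 0 <= K by apply: le_trans (fK point).
have /andP[_ Gx] := G_bounds x.
have KG k : 0 <= k -> k * G X n x <= k * g_hi X n.
  by move=> k0; rewrite ler_wpM2l.
rewrite ler_norml; apply/andP; split.
  apply: le_trans (_ : -K * G X n x <= _); first by rewrite mulNr lerN2 KG.
  have := @Qop_le n (fun=> -K) f (bmeas_cst _ _) bf.
  rewrite Qop_cst; apply => y.
  by have := fK y; rewrite ler_norml => /andP[].
apply: le_trans (KG _ K0).
have := @Qop_le n f (fun=> K) bf (bmeas_cst _ _).
rewrite Qop_cst; apply => y.
by have := fK y; rewrite ler_norml => /andP[].
Qed.

Lemma measurable_Qop_ge0 n (f : E X n.+1 -> R) : bmeas f ->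
  (forall x, 0 <= f x) -> measurable_fun setT (Qop f).
Proof.
move=> bf f0; apply: measurableT_comp => //.
apply: (@measurable_fun_integral_kernel _ _ _ _ _ _ _ (EFin \o f)) => //.
- exact: measurable_Qker.
- by case: bf => mf _; exact/measurable_EFinP.
Qed.

Lemma bmeas_Qop n (f : E X n.+1 -> R) : bmeas f -> bmeas (Qop f).
Proof.
move=> bf; have [mf [K fK]] := bf; split; last first.
  by exists (K * g_hi X n); exact: Qop_norm.
(* Adding the bound [K] makes the integrand nonnegative; the added constant contributes [K * G],
   which is subtracted again. *)
rewrite (_ : Qop f = (fun x => Qop (fun y => f y + K) x - K * G X n x)).
  apply: measurable_funB.
    apply: measurable_Qop_ge0; first by apply: bmeasD => //; exact: bmeas_cst.
    by move=> y; have := fK y; rewrite ler_norml; lra.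
  by apply: measurable_funM => //; exact: measurable_G.
rewrite QopD ?Qop_cst//; last exact: bmeas_cst.
by apply/funext => x; rewrite addrK.
Qed.

End semigroup.

(** * Integration against [Gamma2]: nonnegative functions *)

Section Gamma2_integral.
Context (R : realType) (X : model R) (n : nat).

(* [kcomp] composes with a kernel on a product; the first factor is [unit]. *)
Definition Qker_snd (z : unit * E X n) : {measure set (E X n.+1) -> \bar R} :=
  Qker z.2.

Let measurable_Qker_snd U : measurable U ->
  measurable_fun setT (Qker_snd ^~ U).
Proof. by move=> mU; exact: measurableT_comp (measurable_Qker mU) _. Qed.

HB.instance Definition _ :=
  isKernel.Build _ _ _ _ R Qker_snd measurable_Qker_snd.

Let Qker_snd_uub : measure_fam_uub Qker_snd.
Proof.
(* The uniform bound on a finite kernel is strict, hence the [+ 1]. *)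
exists (g_hi X n + 1) => -[u x]; rewrite [Qker_snd _ _]QkerT lte_fin.
by have /andP[_] := G_bounds x; lra.
Qed.

HB.instance Definition _ :=
  Kernel_isFinite.Build _ _ _ _ R Qker_snd Qker_snd_uub.

Context (m : {posnum R}) (eta : probability (E X n) R).

Let eta_ker : R.-pker unit ~> E X n :=
  kprobability (measurable_cst (eta : pprobability (E X n) R)).

(** [Gamma2 m eta] is rebuilt as a rescaled sum of [mu] and [m] times the composite of [eta], seen
    as a constant kernel on [unit], with [Qker]. Each of these constructions has its own integration
    rule. *)
Lemma ge0_integral_Gamma2 (f : E X n.+1 -> \bar R) :
  (forall x, 0 <= f x)%E -> measurable_fun setT f ->
  (\int[Gamma2 m eta]_x f x = ((Gamma1_val m eta)^-1)%:E *
    (m%:num%:E * \int[eta]_x \int[Qker x]_y f y + \int[mu X n.+1]_x f x))%E.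
Proof.
move=> f0 mf; set cc := (Gamma1_val m eta)^-1.
have c0 : 0 <= cc by rewrite invr_ge0 ltW ?Gamma1_gt0.
pose etaQ : {measure set (E X n.+1) -> \bar R} := kcomp eta_ker Qker_snd tt.
pose m_etaQ : {measure set (E X n.+1) -> \bar R} :=
  mscale (NngNum (ltW [gt0 of m%:num])) etaQ.
pose total : {measure set (E X n.+1) -> \bar R} :=
  measure_add m_etaQ (mu X n.+1).
rewrite (eq_measure_integral (mscale (NngNum c0) total)); last first.
  have totalE A : total A = (m_etaQ A + mu X n.+1 A)%E by exact: measure_addE.
  by move=> A _ _; rewrite [RHS]/= /mscale totalE.
rewrite ge0_integral_mscale// ge0_integral_measure_add//.
by rewrite ge0_integral_mscale// integral_kcomp.
Qed.

End Gamma2_integral.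

(** * Integration against [Gamma2]: signed bounded functions *)

Section Gamma2_Rintegral.
Context (R : realType) (X : model R).

Lemma prob_lty d (T : measurableType d) (eta : probability T R) :
  (eta setT < +oo)%E.
Proof. by rewrite probability_setT ltry. Qed.

Lemma mu_lty n : (mu X n setT < +oo)%E.
Proof. by rewrite ltey_eq fin_num_measure. Qed.

Context (n : nat) (m : {posnum R}) (eta : probability (E X n) R).

Let Rintegral_EFin d (T : measurableType d) (nu : {measure set T -> \bar R})
    (f : T -> R) : (nu setT < +oo)%E -> bmeas f ->
  (\int[nu]_x (f x)%:E = (\int[nu]_x f x)%:E)%E.
Proof.
move=> nuT bf; rewrite /Rintegral fineK//.
exact: integrable_fin_num (bmeas_integrable nuT bf).
Qed.

Let Rintegral_Gamma2_ge0 (f : E X n.+1 -> R) :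
  bmeas f -> (forall x, 0 <= f x) ->
  Gamma1_val m eta * \int[Gamma2 m eta]_x f x =
  m%:num * \int[eta]_x Qop f x + \int[mu X n.+1]_x f x.
Proof.
move=> bf f0.
have mf : measurable_fun setT (EFin \o f).
  by case: bf => mf _; exact/measurable_EFinP.
have := @ge0_integral_Gamma2 R X n m eta (EFin \o f) f0 mf.
rewrite /= !Rintegral_EFin//; [|exact: mu_lty|exact: prob_lty].
under eq_integral => x _ do rewrite Rintegral_EFin ?QkerT_lty//.
rewrite (Rintegral_EFin (prob_lty eta) (bmeas_Qop bf)).
move=> [->]; rewrite mulVKf//; exact: lt0r_neq0 (Gamma1_gt0 _ _).
Qed.

(** The nonnegative case is applied to [f + K] and to the constant [K], and the two identities are
    subtracted. *)
Lemma Rintegral_Gamma2 (f : E X n.+1 -> R) : bmeas f ->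
  Gamma1_val m eta * \int[Gamma2 m eta]_x f x =
  m%:num * \int[eta]_x Qop f x + \int[mu X n.+1]_x f x.
Proof.
move=> bf; have [_ [K fK]] := bf.
have bK : bmeas (fun _ : E X n.+1 => K) by exact: bmeas_cst.
have bi := bmeas_integrable (prob_lty _).
have := Rintegral_Gamma2_ge0 (bmeasD bf bK).
rewrite RintegralD ?(bi _ _ (Gamma2 m eta))//.
rewrite RintegralD//; [|exact: bmeas_integrable (mu_lty _) _..].
rewrite QopD// RintegralD//; [|exact/bi/bmeas_Qop..].
have := Rintegral_Gamma2_ge0 bK.
have K0 : 0 <= K by exact: le_trans (fK point).
move=> /(_ (fun=> K0)) hK /(_ _)/wrap[x|].
  by have := fK x; rewrite ler_norml; lra.
by rewrite mulrDr hK; lra.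
Qed.

End Gamma2_Rintegral.

(** Induction on the final time for predicates that carry the proof of [p <= n], as [Q] and [Gamma]
    do; its two cases match [Q_nn], [Q_S] and [Gamma_nn], [Gamma_S]. *)
Lemma leq_dep_ind p (Pr : forall n, (p <= n)%N -> Prop) :
  Pr p (leqnn p) ->
  (forall n (pn : (p <= n)%N) (pn1 : (p <= n.+1)%N), Pr n pn -> Pr n.+1 pn1) ->
  forall n (pn : (p <= n)%N), Pr n pn.
Proof.
move=> Pp PS; elim=> [|n IHn] pn.
  have p0 : p = 0 by apply/eqP; rewrite -leqn0.
  by subst p; rewrite (bool_irrelevance pn (leqnn 0)).
have [lt_pn|] := boolP (p <= n)%N; first exact: PS (IHn lt_pn).
rewrite -ltnNge => lt_np; have pn1 : p = n.+1 by apply/eqP; rewrite eqn_leq pn.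
by subst p; rewrite (bool_irrelevance pn (leqnn n.+1)).
Qed.

(** * The semigroup [Q] and the closed formula for the flow *)

Section Q_properties.
Context (R : realType) (X : model R).

Lemma bmeas_Q p n (pn : (p <= n)%N) (f : E X n -> R) :
  bmeas f -> bmeas (Q pn f).
Proof.
move: n pn f; apply: leq_dep_ind => [f|n pn pn1 IHn f bf].
  by rewrite Q_nn.
by rewrite (Q_S pn pn1); exact/IHn/bmeas_Qop.
Qed.

Lemma Q_le p n (pn : (p <= n)%N) (f g : E X n -> R) : bmeas f -> bmeas g ->
  (forall x, f x <= g x) -> forall x, Q pn f x <= Q pn g x.
Proof.
move: n pn f g; apply: leq_dep_ind => [f g|n pn pn1 IHn f g bf bg fg].
  by rewrite !Q_nn.
by rewrite !(Q_S pn pn1); apply: IHn; [exact: bmeas_Qop..|exact: Qop_le].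
Qed.

Lemma QZ p n (pn : (p <= n)%N) k (f : E X n -> R) : bmeas f ->
  Q pn (fun x => k * f x) = (fun x => k * Q pn f x).
Proof.
move: n pn f; apply: leq_dep_ind => [f|n pn pn1 IHn f bf].
  by rewrite !Q_nn.
by rewrite !(Q_S pn pn1) QopZ// IHn//; exact: bmeas_Qop.
Qed.

Lemma Q_comp p q n (pq : (p <= q)%N) (qn : (q <= n)%N) (pn : (p <= n)%N)
  (f : E X n -> R) : Q pn f = Q pq (Q qn f).
Proof.
move: n qn pn f; apply: leq_dep_ind => [pn f|n qn qn1 IHn pn1 f].
  by rewrite Q_nn (bool_irrelevance pn pq).
by rewrite (Q_S qn qn1) (Q_S (leq_trans pq qn) pn1) IHn.
Qed.

Lemma bmeas_Q1 p n (pn : (p <= n)%N) : bmeas (Q1 pn : E X p -> R).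
Proof. by apply: bmeas_Q; exact: bmeas_cst. Qed.

Lemma Q_cst p n (pn : (p <= n)%N) k :
  Q pn (fun=> k) = (fun x : E X p => k * Q1 pn x).
Proof.
by rewrite -QZ; [congr Q; apply/funext => x; rewrite mulr1|exact: bmeas_cst].
Qed.

(** Each step multiplies the lower bound by [g_lo]. A bound uniform in [x] is what keeps the ratios
    in the definition of [q] bounded. *)
Lemma Q1_lb p n (pn : (p <= n)%N) :
  exists2 e, 0 < e & forall x : E X p, e <= Q1 pn x.
Proof.
move: n pn; apply: leq_dep_ind => [|n pn pn1 [e e0 eQ]].
  by exists 1 => // x; rewrite /Q1 Q_nn.
exists (g_lo X n * e); first by rewrite mulr_gt0// g_lo_gt0.
move=> x; apply: le_trans (_ : g_lo X n * Q1 pn x <= _).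
  by rewrite ler_wpM2l// ltW// g_lo_gt0.
rewrite [leRHS]/Q1 (Q_S pn pn1) -[leLHS](congr1 (@^~ x) (Q_cst pn (g_lo X n))).
apply: Q_le; [exact: bmeas_cst|by apply: bmeas_Qop; exact: bmeas_cst|].
by move=> y; rewrite Qop_cst mul1r; have /andP[] := G_bounds y.
Qed.

Lemma Q1_gt0 p n (pn : (p <= n)%N) (x : E X p) : 0 < Q1 pn x.
Proof. by have [e e0 /(_ x)] := Q1_lb pn; exact: lt_le_trans. Qed.

(** In the product of mass and probability the normalization cancels: this measure evolves by the
    affine recursion that applies Q_{n+1} and adds mu_{n+1}, and the sum collects the sources
    carried forward to time [n]. *)
Lemma Rintegral_Gamma p n (pn : (p <= n)%N) m (eta : probability (E X p) R)
    (f : E X n -> R) : bmeas f ->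
  let s := Gamma pn (m, eta) in
  s.1%:num * \int[s.2]_x f x = m%:num * \int[eta]_x Q pn f x +
    \sum_(i < n.+1 | (p < i)%N) \int[mu X i]_x Q (leq_ord i) f x.
Proof.
move: n pn f; apply: leq_dep_ind => [f _|n pn pn1 IHn f bf] /=.
  rewrite Gamma_nn Q_nn big_pred0 ?addr0// => i.
  by rewrite ltnNge leq_ord.
rewrite (Gamma_S pn pn1) Rintegral_Gamma2// IHn; last exact: bmeas_Qop.
(* The last index is split off: there Q_{n+1,n+1} is the identity, which leaves the newest
   source. *)
rewrite (Q_S pn pn1) -addrA [in RHS]big_mkcond big_ord_recr /= -big_mkcond/=.
rewrite ltnS pn (bool_irrelevance (leq_ord ord_max) (leqnn n.+1)) Q_nn.
congr (_ + (_ + _)); apply: eq_bigr => i _.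
by rewrite (Q_S (leq_ord i)).
Qed.

End Q_properties.

(** * Bounds on means under a probability measure *)

Section means.
Context d (T : measurableType d) (R : realType).
Implicit Types (eta : probability T R) (f : T -> R) (k : R).

Lemma le_mean eta f k : bmeas f -> (forall x, k <= f x) -> k <= \int[eta]_x f x.
Proof.
move=> bf kf; rewrite -[leLHS]mulr1.
rewrite (_ : 1 = fine (eta setT)); last by rewrite probability_setT.
rewrite -Rintegral_cst//; apply: le_Rintegral => //.
  exact: bmeas_integrable (prob_lty _) (bmeas_cst _ _).
exact: bmeas_integrable (prob_lty _) _.
Qed.

Lemma mean_le eta f k : bmeas f -> (forall x, f x <= k) -> \int[eta]_x f x <= k.
Proof.
move=> bf kf; rewrite -[leRHS]mulr1.
rewrite (_ : 1 = fine (eta setT)); last by rewrite probability_setT.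
rewrite -Rintegral_cst//; apply: le_Rintegral => //.
  exact: bmeas_integrable (prob_lty _) _.
exact: bmeas_integrable (prob_lty _) (bmeas_cst _ _).
Qed.

End means.

(** * The coefficients [q], [betaP], [c], [beta] and [alphaStar] *)

Section coefficients.
Context (R : realType) (X : model R).

Lemma Q1_le_q p n (pn : (p <= n)%N) (x y : E X p) :
  Q1 pn x <= q X pn * Q1 pn y.
Proof.
rewrite -ler_pdivrMr ?Q1_gt0//; apply: ub_le_sup; last by exists (x, y).
have [e e0 eQ] := @Q1_lb _ X p n pn.
have [_ [K QK]] := @bmeas_Q1 _ X p n pn.
exists (K / e) => _ [[u v] _ <-] /=.
apply: ler_pM.
- exact/ltW/Q1_gt0.
- by rewrite invr_ge0 ltW ?Q1_gt0.
- exact: le_trans (ler_norm _) (QK u).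
- by rewrite lef_pV2 ?posrE ?Q1_gt0.
Qed.

Lemma q_ge1 p n (pn : (p <= n)%N) : 1 <= q X pn.
Proof.
have := Q1_le_q pn point point.
by rewrite -{1}[Q1 pn _]mul1r ler_pM2r ?Q1_gt0.
Qed.

Lemma mean_Q1_gt0 p n (pn : (p <= n)%N) (eta : probability (E X p) R) :
  0 < \int[eta]_x Q1 (X := X) pn x.
Proof.
have [e e0 eQ] := @Q1_lb _ X p n pn.
by apply: lt_le_trans e0 _; apply: le_mean => //; exact: bmeas_Q1.
Qed.

(** [Q1_le_q] averaged over its second point. *)
Lemma Q1_le_mean p n (pn : (p <= n)%N) (eta : probability (E X p) R)
    (x : E X p) :
  Q1 pn x <= q X pn * \int[eta]_x Q1 (X := X) pn x.
Proof.
have q0 : 0 < q X pn by apply: lt_le_trans (q_ge1 pn).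
rewrite -ler_pdivrMl//; apply: le_mean; first exact: bmeas_Q1.
by move=> y; rewrite ler_pdivrMl// Q1_le_q.
Qed.

Lemma mean_Q1_le p n (pn : (p <= n)%N) (eta eta' : probability (E X p) R) :
  \int[eta']_x Q1 (X := X) pn x <= q X pn * \int[eta]_x Q1 (X := X) pn x.
Proof. by apply: mean_le; [exact: bmeas_Q1|move=> x; exact: Q1_le_mean]. Qed.

Lemma P_dist_le_betaP p n (pn : (p <= n)%N) (f : E X n -> R) x y : Osc1 f ->
  `|P pn f x - P pn f y| <= betaP X pn.
Proof.
move=> f1; apply: ub_le_sup; last by exists (f, (x, y)).
(* [P] is positive and fixes constants, so it keeps [g] within 1 of [k]. This bounds the set whose
   supremum is [betaP], uniformly over [Osc1]. *)
exists 2 => _ [[g [u v]] [/= g1 _] <-]; pose k := g point.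
have bg := Osc1_bmeas g1.
have gk z : k - 1 <= g z <= k + 1.
  by have := Osc1_dist g1 z point; rewrite ler_norml /k; lra.
have Pgk z : k - 1 <= P pn g z <= k + 1.
  rewrite /P ler_pdivlMr ?ler_pdivrMr ?Q1_gt0//.
  have cst_Q k' : k' * Q1 pn z = Q pn (fun=> k') z by rewrite Q_cst.
  rewrite !cst_Q.
  apply/andP; split; apply: Q_le => //; try exact: bmeas_cst.
    by move=> y'; have /andP[] := gk y'.
  by move=> y'; have /andP[] := gk y'.
by have := Pgk u; have := Pgk v; rewrite ler_norml; lra.
Qed.

Lemma betaP_ge0 p n (pn : (p <= n)%N) : 0 <= betaP X pn.
Proof.
have c1 : @Osc1 _ (E X n) R (fun=> 0).
  by apply: dist_Osc1 => // x y; rewrite subrr.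
by have := P_dist_le_betaP pn point point c1; rewrite subrr normr0.
Qed.

(** Since Q_{p,n} = Q_{p,q} Q_{q,n} with Q_{p,q} positive, a comparison at the intermediate time [q]
    propagates back to [p]. *)
Lemma Q_le_trans p q n (pq : (p <= q)%N) (qn : (q <= n)%N) (pn : (p <= n)%N)
    (f g : E X n -> R) : bmeas f -> bmeas g ->
  (forall y, Q qn f y <= Q qn g y) -> forall x, Q pn f x <= Q pn g x.
Proof.
by move=> bf bg fg x; rewrite !(Q_comp pq qn); apply: Q_le; try exact: bmeas_Q.
Qed.

(* The normalized measure [f |-> eta' Q_{p,n} f / eta' Q_{p,n} 1] is an average
   of the [P_{q,n} f (y)], so it is [betaP]-close to each of them. *)
Lemma mean_flow_dist p q n (pq : (p <= q)%N) (qn : (q <= n)%N) (pn : (p <= n)%N)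
    (eta : probability (E X p) R) (f : E X n -> R) (y : E X q) : Osc1 f ->
  `|P qn f y - \int[eta]_x Q pn f x / \int[eta]_x Q1 (X := X) pn x| <=
  betaP X qn.
Proof.
move=> f1; have bf := Osc1_bmeas f1.
set b := betaP X qn; set Py := P qn f y.
have a0 := mean_Q1_gt0 pn eta.
have Pz z : Py - b <= Q qn f z / Q1 qn z <= Py + b.
  by have := P_dist_le_betaP qn y z f1; rewrite ler_norml -/b -/Py /P; lra.
have cst_Q j (jn : (j <= n)%N) (z : E X j) k :
    k * Q1 jn z = Q jn (fun=> k) z.
  by rewrite Q_cst.
have lo x : (Py - b) * Q1 pn x <= Q pn f x.
  rewrite cst_Q; apply: (Q_le_trans pq pn _ bf); first exact: bmeas_cst.
  move=> z.
  by rewrite -cst_Q -ler_pdivlMr ?Q1_gt0//; have /andP[] := Pz z.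
have hi x : Q pn f x <= (Py + b) * Q1 pn x.
  rewrite cst_Q; apply: (Q_le_trans pq pn bf); first exact: bmeas_cst.
  move=> z.
  by rewrite -cst_Q -ler_pdivrMr ?Q1_gt0//; have /andP[] := Pz z.
have bQ1 := @bmeas_Q1 _ X _ _ pn.
have int g := @bmeas_integrable _ _ _ eta g (prob_lty _).
have iQ1 k : \int[eta]_x (k * Q1 (X := X) pn x) =
             k * \int[eta]_x Q1 (X := X) pn x.
  by rewrite RintegralZl//; exact: int.
have : Py - b <= \int[eta]_x Q pn f x / \int[eta]_x Q1 (X := X) pn x <= Py + b.
  rewrite ler_pdivlMr// ler_pdivrMr// -!iQ1; apply/andP; split.
    by apply: le_Rintegral => //; apply: int; [exact: bmeasZ|exact: bmeas_Q].
  by apply: le_Rintegral => //; apply: int; [exact: bmeas_Q|exact: bmeasZ].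
by rewrite ler_norml; lra.
Qed.

Lemma c_ge0 p n (pn : (p <= n)%N) : 0 <= c X pn.
Proof. by apply: Rintegral_ge0 => x _; exact/ltW/Q1_gt0. Qed.

Lemma csum_ge0 p n : 0 <= csum X p n.
Proof. by apply: sumr_ge0 => i _; exact: c_ge0. Qed.

(** The division-free form also covers [csum = 0]: the [c] are nonnegative, so all of them vanish
    and both sides are 0. *)
Lemma csum_beta p n : csum X p n * beta X p n =
  \sum_(i < n.+1 | (p < i)%N) c X (leq_ord i) * betaP X (leq_ord i).
Proof.
rewrite /beta; case: eqP => [C0|/eqP C0].
  rewrite mulr0 big1// => i pi.
  have := psumr_eq0P (fun i _ => c_ge0 (leq_ord i)) C0.
  by move=> /(_ i pi) ->; rewrite mul0r.
rewrite big_distrr/=; apply: eq_bigr => i _.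
by rewrite mulrA [_ / _]mulrC mulVKf.
Qed.

Lemma beta_ge0 p n : 0 <= beta X p n.
Proof.
rewrite /beta; case: eqP => // _; apply: sumr_ge0 => i _.
by rewrite mulr_ge0 ?betaP_ge0// divr_ge0 ?c_ge0 ?csum_ge0.
Qed.

(** [mean_flow_dist] holds at every point of E_i; multiplied by [Q1] and integrated against mu_i, it
    bounds the [i]-th term by [c * betaP]. *)
Lemma source_dist p n (pn : (p <= n)%N) (eta : probability (E X p) R)
    (f : E X n -> R) : Osc1 f ->
  `|\sum_(i < n.+1 | (p < i)%N) \int[mu X i]_x Q (leq_ord i) f x -
    csum X p n * (\int[eta]_x Q pn f x / \int[eta]_x Q1 (X := X) pn x)| <=
  csum X p n * beta X p n.
Proof.
move=> f1; have bf := Osc1_bmeas f1.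
rewrite csum_beta /csum big_distrl/= -sumrB.
apply: le_trans (ler_norm_sum _ _ _) _; apply: ler_sum => i pi.
set u := _ / _; set b := betaP _ _.
have Pu x : u - b <= Q (leq_ord i) f x / Q1 (leq_ord i) x <= u + b.
  by have := mean_flow_dist (ltnW pi) (leq_ord i) pn eta x f1;
    rewrite ler_norml -/u -/b /P; lra.
have bQ1 := @bmeas_Q1 _ X _ _ (leq_ord i).
have bQ : bmeas (Q (leq_ord i) f) by exact: bmeas_Q.
have int g := @bmeas_integrable _ _ _ (mu X i) g (mu_lty _ _).
have iQ1 k : \int[mu X i]_x (k * Q1 (leq_ord i) x) = k * c X (leq_ord i).
  by rewrite RintegralZl//; exact: int.
have : (u - b) * c X (leq_ord i) <= \int[mu X i]_x Q (leq_ord i) f x <=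
       (u + b) * c X (leq_ord i).
  rewrite -!iQ1; apply/andP; split; apply: le_Rintegral => //;
    try (by apply: int => //; exact: bmeasZ); move=> x _.
    by rewrite -ler_pdivlMr ?Q1_gt0//; have /andP[] := Pu x.
  by rewrite -ler_pdivrMr ?Q1_gt0//; have /andP[] := Pu x.
by rewrite ler_norml; lra.
Qed.

(** The weight is at most 1 because [csum] is nonnegative. For the other bound, the mean of [Q1] is
    at most [csum * N], with [N] the norm in [alphaStar], and [csum] is at most the full
    denominator. *)
Lemma weight_le_alphaStar p n (pn : (p <= n)%N) (eta : probability (E X p) R)
    (m : R) : 0 < m <= m_plus X p ->
  m * \int[eta]_x Q1 (X := X) pn x <=
  alphaStar X pn * (m * \int[eta]_x Q1 (X := X) pn x + csum X p n).
Proof.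
move=> /andP[m0 mp]; have := mean_Q1_gt0 pn eta; set a := Rintegral _ _ _ => a0.
have ma0 : 0 < m * a by rewrite mulr_gt0.
rewrite /alphaStar; case: eqP => [->|/eqP C0]; first by rewrite mul1r addr0.
have {}C0 : 0 < csum X p n by rewrite lt_def C0 csum_ge0.
set N := unif_norm _.
have aN : a <= csum X p n * N.
  apply: mean_le; first exact: bmeas_Q1.
  move=> x; rewrite -ler_pdivrMl// mulrC -[leLHS]gtr0_norm; last first.
    by rewrite divr_gt0 ?Q1_gt0.
  have [_ [K QK]] := @bmeas_Q1 _ X p n pn.
  apply: ub_le_sup; last by exists x.
  exists (K / csum X p n) => _ [y _ <-] /=.
  by rewrite normrM [`|_^-1|]gtr0_norm ?invr_gt0// ler_pM2r ?invr_gt0.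
have N0 : 0 <= N by rewrite -(pmulr_rge0 _ C0) (le_trans (ltW a0)).
rewrite -ler_pdivrMr ?addr_gt0// le_min !ler_pdivrMr ?addr_gt0//.
rewrite mul1r lerDl ltW//=.
apply: le_trans (_ : m_plus X p * N * csum X p n <= _); last first.
  apply: ler_wpM2l; last by rewrite lerDr ltW.
  by rewrite mulr_ge0// (le_trans (ltW m0)).
by rewrite -mulrA [N * _]mulrC ler_pM// ltW.
Qed.

End coefficients.

(** The real-number inequality left once the probabilistic facts are hypotheses: [g], [g'] stand for
    the two integrals of [f], [b] for eta Q_{p,n}(f), [be] for [betaP], [bn] for [beta], and [dD],
    [dh] for the differences of means of [D] and [h]. *)
Lemma contraction_bound (R : realFieldType)
    (m a a' b u S C g g' al q be bn dD dh : R) :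
  0 < m -> 0 < a -> 0 < a' -> 0 <= C -> 1 <= q -> 0 <= be -> 0 <= bn ->
  (m * a + C) * g = m * b + S -> (m * a' + C) * g' = m * (a' * u) + S ->
  b - a * u = q * a' * be * dD -> a - a' = 2 * q * a' * dh ->
  a' <= q * a -> `|S - C * u| <= C * bn ->
  m * a <= al * (m * a + C) -> m * a' <= al * (m * a' + C) ->
  `|g - g'| <= 2 * al * q * (q * be * `|dD| + bn * `|dh|).
Proof.
move=> m0 a0 a'0 C0 q1 be0 bn0 gE g'E bE aE a'q Su ala ala'.
set w := m * a + C in gE ala *; set w' := m * a' + C in g'E ala' *.
have w0 : 0 < w by rewrite ltr_wpDr// mulr_gt0.
have w'0 : 0 < w' by rewrite ltr_wpDr// mulr_gt0.
have q0 : 0 < q by exact: lt_le_trans q1.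
have al0 : 0 < al by rewrite -(pmulr_lgt0 _ w0) (lt_le_trans _ ala)// mulr_gt0.
have -> : g - g' =
    m * (b - a * u) / w - (S - C * u) * (m * (a - a')) / (w * w').
  apply: (mulfI (lt0r_neq0 w0)); apply: (mulfI (lt0r_neq0 w'0)).
  have -> : w' * (w * (g - g')) = w' * (w * g) - w * (w' * g') by ring.
  rewrite gE g'E.
  by rewrite /w /w'; field; rewrite !lt0r_neq0.
rewrite [leRHS]mulrDr; apply: le_trans (ler_normB _ _) _; apply: lerD.
  rewrite bE normrM [`|w^-1|]gtr0_norm ?invr_gt0// ler_pdivrMr//.
  rewrite !normrM [`|m|]gtr0_norm// [`|q|]gtr0_norm// [`|a'|]gtr0_norm//
    [`|be|]ger0_norm//.
  (* Here [a'] stands over the denominator [w] of [eta]; passing from [a'] to [a] costs the second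
     factor [q]. *)
  have : m * a' <= q * (al * w).
    rewrite (le_trans (_ : _ <= q * (m * a)))//; last by rewrite ler_pM2l.
    by rewrite mulrCA ler_pM2l.
  move: (normr_ge0 dD); move: `|dD| => D D0 h.
  have : (m * a') * (q * be * D) <= (q * (al * w)) * (q * be * D).
    by rewrite ler_wpM2r// mulr_ge0// mulr_ge0// ltW.
  (* The bound so far has constant 1; nonnegativity allows the 2, which the second term inherits
     from the normalization of [h]. *)
  have : 0 <= (q * (al * w)) * (q * be * D) by rewrite !mulr_ge0// ltW.
  lra.
rewrite aE normrM [`|(w * w')^-1|]gtr0_norm ?invr_gt0 ?mulr_gt0//.
rewrite ler_pdivrMr ?mulr_gt0// normrM.
rewrite [X in _ * X](_ : _ = 2 * q * (m * a') * `|dh|); last first.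
  have -> : m * (2 * q * a' * dh) = 2 * q * (m * a') * dh by ring.
  by rewrite normrM gtr0_norm// !mulr_gt0.
move: (normr_ge0 dh); move: `|dh| => h h0.
(* The weight [m * a' / w'] is at most [al]; the remaining [C / w] is at most 1. *)
rewrite (le_trans (_ : _ <= (C * bn) * (2 * q * (al * w') * h)))//.
  apply: ler_pM => //; first by rewrite !mulr_ge0// ltW.
  by rewrite ler_wpM2r// ler_pM2l ?mulr_gt0.
have -> : C * bn * (2 * q * (al * w') * h) = C * (2 * al * q * (bn * h) * w').
  by ring.
have -> : 2 * al * q * (bn * h) * (w * w') = w * (2 * al * q * (bn * h) * w').
  by ring.
apply: ler_wpM2r; first by rewrite !mulr_ge0// ltW.
by rewrite lerDr ltW// mulr_gt0.
Qed.

(** * The functions [h] and [D] *)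

Section potential.
Context (R : realType) (X : model R) (p n : nat) (pn : (p <= n)%N).
Context (eta' : probability (E X p) R).

Lemma bmeas_h : bmeas (h pn eta').
Proof.
apply: bmeasZ.
rewrite (_ : (fun x => _) =
    (fun x => (\int[eta']_y Q1 (X := X) pn y)^-1 * Q1 pn x)).
  exact/bmeasZ/bmeas_Q1.
by apply/funext => x; rewrite mulrC.
Qed.

Lemma Osc1_h : Osc1 (h pn eta').
Proof.
apply: dist_Osc1; first by case: bmeas_h.
have q0 : 0 < q X pn by apply: lt_le_trans (q_ge1 X pn).
have a0 := mean_Q1_gt0 pn eta'.
(* Values in the interval from 0 to 1 give oscillation at most 1; the upper bound comes from
   [Q1_le_mean]. *)
have h0 x : 0 < h pn eta' x.
  by apply: mulr_gt0; rewrite ?divr_gt0 ?invr_gt0 ?mulr_gt0// Q1_gt0.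
have h1 x : h pn eta' x <= 1.
  rewrite /h mulrC ler_pdivrMr ?mulr_gt0// mul1r ler_pdivrMr//.
  by have := Q1_le_mean pn eta' x; have := mulr_gt0 q0 a0; lra.
by move=> x y; have := h0 y; have := h1 x; lra.
Qed.

Lemma mean_h (eta : probability (E X p) R) :
  \int[eta]_x Q1 (X := X) pn x - \int[eta']_x Q1 (X := X) pn x =
  2 * q X pn * \int[eta']_x Q1 (X := X) pn x *
  (\int[eta]_x h pn eta' x - \int[eta']_x h pn eta' x).
Proof.
set a' := \int[eta']_x _.
have a0 : 0 < a' by exact: mean_Q1_gt0.
have q0 : 0 < q X pn by apply: lt_le_trans (q_ge1 X pn).
have hE (nu : probability (E X p) R) :
    \int[nu]_x Q1 (X := X) pn x = 2 * q X pn * a' * \int[nu]_x h pn eta' x.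
  rewrite -RintegralZl//; last exact: bmeas_integrable (prob_lty _) bmeas_h.
  congr Rintegral; apply/funext => x; rewrite /h -/a'.
  by field; rewrite !lt0r_neq0.
by rewrite mulrBr -!hE.
Qed.

Lemma exists_direction (f : E X n -> R) : Osc1 f ->
  let a' := \int[eta']_x Q1 (X := X) pn x in
  let u := \int[eta']_x Q pn f x / a' in
  exists2 D : E X p -> R, Osc1 D &
    forall x, Q pn f x - u * Q1 pn x = q X pn * a' * betaP X pn * D x.
Proof.
move=> f1 a' u; have bf := Osc1_bmeas f1.
have a0 : 0 < a' by exact: mean_Q1_gt0.
have q0 : 0 < q X pn by apply: lt_le_trans (q_ge1 X pn).
have qa0 : 0 < q X pn * a' by rewrite mulr_gt0.
have Pu x : `|P pn f x - u| <= betaP X pn.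
  exact: (mean_flow_dist (leqnn p) pn pn eta' x f1).
pose D x := (q X pn * a' * betaP X pn)^-1 * (Q pn f x - u * Q1 pn x).
have bD : bmeas D.
  by apply/bmeasZ/bmeasB; [exact: bmeas_Q|exact/bmeasZ/bmeas_Q1].
have QE x : Q pn f x - u * Q1 pn x = Q1 pn x * (P pn f x - u).
  by rewrite /P; field; rewrite lt0r_neq0 ?Q1_gt0.
(* If [betaP] is 0, then [P pn f] is constantly [u], the left side vanishes and [D = 0] works;
   otherwise [D] is obtained by division. *)
have := betaP_ge0 X pn; rewrite le_eqVlt => /orP[/eqP b0|b0].
  exists (fun=> 0); first by apply: dist_Osc1 => // x y; rewrite subrr.
  move=> x; rewrite mulr0 QE; have := Pu x.
  by rewrite -b0 normr_le0 => /eqP ->; rewrite mulr0.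
exists D; last by move=> x; rewrite mulVKf// lt0r_neq0// mulr_gt0.
apply: dist_Osc1; first by case: bD.
(* [D = w s] with [0 <= w <= 1], [|s| <= 1] and [osc s <= 1] *)
move=> x y; pose w (z : E X p) := Q1 pn z / (q X pn * a').
pose s z := (P pn f z - u) / betaP X pn.
have DE z : D z = w z * s z.
  by rewrite /D QE /w /s; field; rewrite !lt0r_neq0.
have w0 z : 0 <= w z by rewrite ltW// divr_gt0// Q1_gt0.
have w1 z : w z <= 1 by rewrite ler_pdivrMr// mul1r Q1_le_mean.
have s1 z : -1 <= s z <= 1.
  rewrite -ler_norml normrM [`|_^-1|]gtr0_norm ?invr_gt0//.
  by rewrite ler_pdivrMr// mul1r.
have ss : s x - s y <= 1.
  rewrite -mulrBl ler_pdivrMr// mul1r opprB addrA subrK.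
  exact: le_trans (ler_norm _) (P_dist_le_betaP pn x y f1).
rewrite !DE; have := s1 x; have := s1 y.
move: (w0 x) (w0 y) (w1 x) (w1 y) ss.
move: (w x) (w y) (s x) (s y) => wx wy sx sy wx0 wy0 wx1 wy1 ss.
move=> /andP[sy1 sy2] /andP[sx1 sx2].
(* If [sx >= 0 > sy], the weights only shrink [sx - sy], which is at most 1. In the other cases at
   most one of [wx * sx] and [- wy * sy] is positive, and it is at most 1. *)
have [sx0|sx0] := lerP 0 sx; have [sy0|sy0] := lerP 0 sy; nra.
Qed.

End potential.

(** * Assembly of the contraction estimate *)

Theorem proposition4p5 (R : realType) (X : model R) (p n : nat)
    (pn : (p <= n)%N) (eta' : probability (E X p) R) (f : E X n -> R)
    (hf : Osc1 f) :
  Osc1 (h pn eta') /\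
  exists D : E X p -> R, Osc1 D /\
    forall (eta : probability (E X p) R) (m : {posnum R}),
      m_minus X p <= m%:num <= m_plus X p ->
      `| \int[(Gamma pn (m, eta)).2]_x f x
         - \int[(Gamma pn (m, eta')).2]_x f x |
      <= 2 * alphaStar X pn * q X pn *
         (q X pn * betaP X pn * `| \int[eta]_x D x - \int[eta']_x D x |
          + beta X p n *
            `| \int[eta]_x h pn eta' x - \int[eta']_x h pn eta' x |).
Proof.
split; first exact: Osc1_h.
have bf := Osc1_bmeas hf.
have [D D1 DE] := exists_direction pn eta' hf.
exists D; split=> // eta m /andP[_ mp].
have m0 : 0 < m%:num <= m_plus X p by rewrite gt0.
have bQ := @bmeas_Q _ X _ _ pn _ bf; have bQ1 := @bmeas_Q1 _ X _ _ pn.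
have b1 : bmeas (fun _ : E X n => 1 : R) by exact: bmeas_cst.
pose S := \sum_(i < n.+1 | (p < i)%N) \int[mu X i]_x Q (leq_ord i) f x.
have GE (nu : probability (E X p) R) :
    (m%:num * \int[nu]_x Q1 (X := X) pn x + csum X p n) *
      \int[(Gamma pn (m, nu)).2]_x f x =
    m%:num * \int[nu]_x Q pn f x + S.
  rewrite -(Rintegral_Gamma pn m nu bf); congr (_ * _).
  (* The closed formula at the constant 1 identifies the mass component of the flow with the
     denominator. *)
  rewrite -[LHS](Rintegral_Gamma pn m nu b1) Rintegral_cst//.
  by rewrite [X in fine X](_ : _ = 1%E) ?mulr1; last exact: probability_setT.
set a' := \int[eta']_x Q1 (X := X) pn x in DE.
set u := _ / a' in DE.
have a'0 : 0 < a' by exact: mean_Q1_gt0.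
have int (nu : probability (E X p) R) g :=
  @bmeas_integrable _ _ _ nu g (prob_lty _).
have DnuE (nu : probability (E X p) R) :
    \int[nu]_x Q pn f x - \int[nu]_x Q1 (X := X) pn x * u =
    q X pn * a' * betaP X pn * \int[nu]_x D x.
  rewrite [_ * u]mulrC -[u * _]RintegralZl//; last exact: int nu _ bQ1.
  rewrite -RintegralB//; [|exact: int nu _ bQ|exact: int nu _ (bmeasZ u bQ1)].
  rewrite -RintegralZl//; last exact: int nu _ (Osc1_bmeas D1).
  by congr Rintegral; apply/funext => x.
(* The choice of [u] centres the integrand under [eta'], so this term can be subtracted to produce
   the difference of means. It is stated for the product because [betaP] may be 0. *)
have D'0 : q X pn * a' * betaP X pn * \int[eta']_x D x = 0.
  by rewrite -DnuE /u mulrCA divff ?mulr1 ?subrr// lt0r_neq0.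
apply: (@contraction_bound R m%:num (\int[eta]_x Q1 (X := X) pn x) a'
  (\int[eta]_x Q pn f x) u S (csum X p n)) => //.
- exact: mean_Q1_gt0.
- exact: csum_ge0.
- exact: q_ge1.
- exact: betaP_ge0.
- exact: beta_ge0.
- by rewrite GE /u [a' * _]mulrC divfK// lt0r_neq0.
- by rewrite mulrBr D'0 subr0 DnuE.
- exact: mean_h.
- exact: mean_Q1_le.
- exact: source_dist.
- exact: weight_le_alphaStar.
- exact: weight_le_alphaStar.
Qed.
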